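(* Let $\mathbb{A}$ be a perfect Heyting algebra, let $a\in A$, let $\chi$ be a classical Sahlqvist formula, and let $\alpha$ be the local frame correspondent of $\chi$ obtained by the classical Sahlqvist–van Benthem algorithm. Then $\chi$ and $\alpha$ are local frame $a$-correspondents over $\mathbb{A}$-frames: for every $\mathbb{A}$-frame $\mathfrak{F}=(W,R)$ and $w\in W$, $\mathfrak{F},w\Vdash_a\chi$ iff $\mathfrak{F}\models_a\alpha[x:=w]$.
   Context: $\mathbb{A}=(A,\vee,\wedge,\rightarrow,0,1)$ is a Heyting algebra whose lattice is complete, with completely join-irreducible elements join-dense and completely meet-irreducible elements meet-dense. An $\mathbb{A}$-frame is $(W,R)$ with $W\ne\emptyset$, $R:W\times W\to A$. $L_{\mathbb{A}}$-formulas: $\phi::=\mathbf{a}\mid p\mid\phi\vee\phi\mid\phi\wedge\phi\mid\phi\rightarrow\phi\mid\Box\phi\mid\Diamond\phi$ ($\mathbf{a}$ a constant for each $a\in A$; $\mathbf{0},\mathbf{1}$ the constants for $0,1$), with $\neg\phi:=\phi\rightarrow\mathbf{0}$. Valuations $V$ assign values in $A$ to propositional variables at states, extended by $V(\mathbf{a},w)=a$, $\vee,\wedge,\rightarrow$ pointwise, $V(\Diamond\phi,w)=\bigvee_u(R(w,u)\wedge V(\phi,u))$, $V(\Box\phi,w)=\bigwedge_u(R(w,u)\rightarrow V(\phi,u))$. $\mathfrak{F},w\Vdash_a\phi$ means $V(\phi,w)\ge a$ for all valuations $V$. First-order frame formulas (over $=$ and $R$) are evaluated $A$-valuedly: $\|t_1=t_2\|\in\{0,1\}$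 according to equality, $\|Rt_1t_2\|=R(v(t_1),v(t_2))$, connectives $\vee,\wedge,\rightarrow$ in $\mathbb{A}$ (with $\neg\beta=\beta\rightarrow\mathbf{0}$, $\bot=\mathbf{0}$, $\top=\mathbf{1}$), $\forall,\exists$ as meets/joins over variants of the assignment; $\mathfrak{F}\models_a\alpha[x:=w]$ means the value is $\ge a$ under every assignment sending $x$ to $w$. $\chi$ and $\alpha(x)$ are local frame $a$-correspondents if for all $\mathbb{A}$-frames $\mathfrak{F}$ and states $w$: $\mathfrak{F},w\Vdash_a\chi$ iff $\mathfrak{F}\models_a\alpha[x:=w]$. A propositional variable occurrence is positive (negative) if it is reached with an even (odd) number of passages into the left argument of $\rightarrow$; a formula is positive (negative) if all variable occurrences in it are. A boxed atom is $\Box^np$ ($n\ge0$ boxes). A classical Sahlqvist antecedent is built from $\mathbf{0}$, $\mathbf{1}$, boxed atoms and negative formulas using $\wedge,\vee,\Diamond$. A classical Sahlqvist implication is $\phi\rightarrow\psi$ with $\phi$ a classical Sahlqvist antecedent and $\psi$ positive. A classical Sahlqvist formula is built from classical Sahlqvist implications using $\Box$ and $\wedge$ without restriction and $\vee$ only between formulas with no propositional variables in common. The classical Sahlqvist–van Benthem algorithm (as in Blackburn, de Rijke and Venema, Modal Logic) computes, for such a formula, a first-order formula $\alpha(x)$ in $=$ and $R$ that is its local correspondent over ordinary two-valued Kripke frames (via standard translation, pulling out existential quantifiers from the antecedent and substituting the minimal instantiations $\lambda y.\bigvee_j R^{r_j}x_{i_j}y$ for the predicate variables); this same syntactic formula $\alpha$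 is here evaluated $A$-valuedly.
   Formalization: The algorithm here keeps negative conjuncts of the antecedent on the left of the implication in α; the textbook step moving them to the consequent as negated disjuncts is only classically valid, and with it the claim fails over some perfect Heyting algebras (e.g. p∧¬◇p→◇◇p). *)

(* Defs.v *)
From HB Require Import structures.
From mathcomp Require Import all_boot all_order.
From mathcomp Require Import boolp classical_sets.

Set Implicit Arguments.
Unset Strict Implicit.
Unset Printing Implicit Defensive.

Import Order.Theory.

Local Open Scope classical_set_scope.
Local Open Scope order_scope.

HB.mixin Record TBLattice_isHeyting (d : Order.disp_t) (H : Type)
    of Order.TBLattice d H := {
  himp : H -> H -> H;
  himpP : forall x y z : H, (Order.meet x y <= z) = (x <= himp y z)
}.

#[short(type="heytingType")]
HB.structure Definition Heyting (d : Order.disp_t) :=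
  { H of TBLattice_isHeyting d H & Order.TBLattice d H }.

Section Perfect.
Context {d : Order.disp_t} (A : heytingType d).

Definition complete_lattice : Prop :=
  forall S : set A, supremums S !=set0 /\ infimums S !=set0.

(* S may be empty, so \bot is not completely join-irreducible and \top is not *)
(* completely meet-irreducible.                                               *)
Definition completely_join_irreducible (j : A) : Prop :=
  forall S : set A, supremums S j -> S j.

Definition completely_meet_irreducible (m : A) : Prop :=
  forall S : set A, infimums S m -> S m.

Definition join_dense (J : set A) : Prop :=
  forall x : A, exists2 S : set A, S `<=` J & supremums S x.

Definition meet_dense (M : set A) : Prop :=
  forall x : A, exists2 S : set A, S `<=` M & infimums S x.

Definition perfect : Prop :=
  [/\ complete_lattice,
      join_dense [set j | completely_join_irreducible j] &
      meet_dense [set m | completely_meet_irreducible m]].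

(* These are the least upper and greatest lower bounds of the family f        *)
(* whenever A is complete, including when I is empty.                         *)
Definition bigjoin {I : Type} (f : I -> A) : A := supremum \bot (range f).
Definition bigmeet {I : Type} (f : I -> A) : A := infimum \top (range f).

End Perfect.

Record frame {d : Order.disp_t} (A : heytingType d) : Type := Frame {
  state :> Type;
  state_inhabited : inhabited state;
  acc : state -> state -> A
}.

Inductive form (A : Type) : Type :=
| Const of A
| Var of nat
| Or of form A & form A
| And of form A & form A
| Imp of form A & form A
| Box of form A
| Dia of form A.

Arguments Var {A} _.

Section ModalSemantics.
Context {d : Order.disp_t} {A : heytingType d} (F : frame A).

Fixpoint value (V : nat -> F -> A) (phi : form A) (w : F) : A :=
  match phi with
  | Const a => a
  | Var p => V p w
  | Or phi psi => Order.join (value V phi w) (value V psi w)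
  | And phi psi => Order.meet (value V phi w) (value V psi w)
  | Imp phi psi => himp (value V phi w) (value V psi w)
  | Box phi => bigmeet (fun u : F => himp (acc w u) (value V phi u))
  | Dia phi => bigjoin (fun u : F => Order.meet (acc w u) (value V phi u))
  end.

Definition valid_at (w : F) (a : A) (phi : form A) : Prop :=
  forall V : nat -> F -> A, a <= value V phi w.

End ModalSemantics.

(* First-order formulas over =, R and unary predicate symbols drawn from P,   *)
(* with variables named by natural numbers. P is nat (one predicate symbol    *)
(* per propositional variable) for standard translations and void for frame   *)
(* formulas. The constants of A that can occur in the output of the algorithm *)
(* are those of the modal formula, together with \bot and \top.               *)
Inductive fo (A P : Type) : Type :=
| FConst of A
| FEq of nat & nat
| FRel of nat & nat
| FPred of P & nat
| FOr of fo A P & fo A P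
| FAnd of fo A P & fo A P
| FImp of fo A P & fo A P
| FAll of nat & fo A P
| FEx of nat & fo A P.

Arguments FConst {A P} _.
Arguments FEq {A P} _ _.
Arguments FRel {A P} _ _.
Arguments FPred {A P} _ _.

Definition frame_form (A : Type) : Type := fo A void.

Section FirstOrderSemantics.
Context {d : Order.disp_t} {A : heytingType d} (F : frame A).

Definition update (v : nat -> F) (x : nat) (u : F) : nat -> F :=
  fun y => if y == x then u else v y.

Fixpoint fo_value (v : nat -> F) (alpha : frame_form A) : A :=
  match alpha with
  | FConst a => a
  | FEq x y => if `[< v x = v y >] then \top else \bot
  | FRel x y => acc (v x) (v y)
  | FPred p _ => match p with end
  | FOr alpha beta => Order.join (fo_value v alpha) (fo_value v beta)
  | FAnd alpha beta => Order.meet (fo_value v alpha) (fo_value v beta)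
  | FImp alpha beta => himp (fo_value v alpha) (fo_value v beta)
  | FAll x alpha => bigmeet (fun u : F => fo_value (update v x u) alpha)
  | FEx x alpha => bigjoin (fun u : F => fo_value (update v x u) alpha)
  end.

Definition fo_valid_at (x : nat) (w : F) (a : A) (alpha : frame_form A) : Prop :=
  forall v : nat -> F, v x = w -> a <= fo_value v alpha.

End FirstOrderSemantics.

(* The free variable of alpha(x) is the variable named x. *)
Definition local_frame_correspondents {d : Order.disp_t} {A : heytingType d}
    (a : A) (chi : form A) (x : nat) (alpha : frame_form A) : Prop :=
  forall (F : frame A) (w : F),
    valid_at w a chi <-> fo_valid_at x w a alpha.

Section Sahlqvist.
Context {d : Order.disp_t} {A : heytingType d}.
Implicit Types phi psi : form A.

Fixpoint vars phi : seq nat :=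
  match phi with
  | Const _ => [::]
  | Var p => [:: p]
  | Or phi psi | And phi psi | Imp phi psi => vars phi ++ vars psi
  | Box phi | Dia phi => vars phi
  end.

(* polarized b phi: every occurrence of a variable in phi is positive         *)
(* (b = true), resp. negative (b = false).                                    *)
Fixpoint polarized (b : bool) phi : bool :=
  match phi with
  | Const _ => true
  | Var _ => b
  | Or phi psi | And phi psi => polarized b phi && polarized b psi
  | Imp phi psi => polarized (~~ b) phi && polarized b psi
  | Box phi | Dia phi => polarized b phi
  end.

Definition positive phi : bool := polarized true phi.
Definition negative phi : bool := polarized false phi.

(* The grammar is ambiguous (the diamond of a negative formula is itself a    *)
(* negative formula), and the run of the algorithm depends on how the         *)
(* antecedent is parsed. Derivations are therefore Type-valued and the        *)
(* algorithm recurses on them, so that every parse is accounted for.          *)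
Inductive sahlqvist_antecedent : form A -> Type :=
| SqBot : sahlqvist_antecedent (Const \bot)
| SqTop : sahlqvist_antecedent (Const \top)
| SqBoxedAtom (n p : nat) : sahlqvist_antecedent (iter n (@Box A) (Var p))
| SqNegative phi : negative phi -> sahlqvist_antecedent phi
| SqAnd phi psi : sahlqvist_antecedent phi -> sahlqvist_antecedent psi ->
    sahlqvist_antecedent (And phi psi)
| SqOr phi psi : sahlqvist_antecedent phi -> sahlqvist_antecedent psi ->
    sahlqvist_antecedent (Or phi psi)
| SqDia phi : sahlqvist_antecedent phi -> sahlqvist_antecedent (Dia phi).

Inductive sahlqvist : form A -> Type :=
| SqImplication phi psi : sahlqvist_antecedent phi -> positive psi ->
    sahlqvist (Imp phi psi)
| SqBox phi : sahlqvist phi -> sahlqvist (Box phi)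
| SqConj phi psi : sahlqvist phi -> sahlqvist psi -> sahlqvist (And phi psi)
| SqDisj phi psi : sahlqvist phi -> sahlqvist psi ->
    {in vars phi, forall p, p \notin vars psi} -> sahlqvist (Or phi psi).

End Sahlqvist.

Section Algorithm.
Context {d : Order.disp_t} {A : heytingType d}.

Definition fo_conj (P : Type) (s : seq (fo A P)) : fo A P :=
  foldr (@FAnd A P) (FConst \top) s.
Definition fo_disj (P : Type) (s : seq (fo A P)) : fo A P :=
  foldr (@FOr A P) (FConst \bot) s.

(* The standard translation of phi at the variable x. The variables bound in  *)
(* it are n, n + 1, ...; x and every variable in scope must be smaller than n.*)
Fixpoint ST (n x : nat) (phi : form A) : fo A nat :=
  match phi with
  | Const a => FConst a
  | Var p => FPred p x
  | Or phi psi => FOr (ST n x phi) (ST n x psi)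
  | And phi psi => FAnd (ST n x phi) (ST n x psi)
  | Imp phi psi => FImp (ST n x phi) (ST n x psi)
  | Box phi => FAll n (FImp (FRel x n) (ST n.+1 n phi))
  | Dia phi => FEx n (FAnd (FRel x n) (ST n.+1 n phi))
  end.

(* Replaces each atom P y by sigma P y. No capture occurs in the uses below:  *)
(* the parameters of sigma are smaller than the bound variables of ST.        *)
Fixpoint subst (sigma : nat -> nat -> frame_form A) (beta : fo A nat) :
    frame_form A :=
  match beta with
  | FConst a => FConst a
  | FEq x y => FEq x y
  | FRel x y => FRel x y
  | FPred p x => sigma p x
  | FOr beta gamma => FOr (subst sigma beta) (subst sigma gamma)
  | FAnd beta gamma => FAnd (subst sigma beta) (subst sigma gamma)
  | FImp beta gamma => FImp (subst sigma beta) (subst sigma gamma)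
  | FAll x beta => FAll x (subst sigma beta)
  | FEx x beta => FEx x (subst sigma beta)
  end.

Fixpoint Rpow (r x y : nat) : frame_form A :=
  match r with
  | 0 => FEq x y
  | 1 => FRel x y
  | r'.+1 => let z := (maxn x y).+1 in FEx z (FAnd (FRel x z) (Rpow r' z y))
  end.

(* One disjunct of an antecedent after its existential quantifiers have been  *)
(* pulled out: it stands for                                                  *)
(*   exists cvars, crel /\ BOX-AT /\ NEG                                      *)
(* where BOX-AT is the conjunction over (p, r, y) in cbox of the translations *)
(* at y of the boxed atoms Box^r p, and NEG is the conjunction over (y, nu)   *)
(* in cneg of the translations at y of the negative formulas nu.              *)
Record clause : Type := Clause {
  cvars : seq nat;
  crel : frame_form A;
  cbox : seq (nat * nat * nat);
  cneg : seq (nat * form A)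
}.

Definition clause_and (c1 c2 : clause) : clause :=
  Clause (cvars c1 ++ cvars c2) (FAnd (crel c1) (crel c2))
         (cbox c1 ++ cbox c2) (cneg c1 ++ cneg c2).

Definition clause_dia (x y : nat) (c : clause) : clause :=
  Clause (y :: cvars c) (FAnd (FRel x y) (crel c)) (cbox c) (cneg c).

(* The disjuncts of the antecedent at x, using fresh variables from n on,     *)
(* together with the next unused variable.                                    *)
Fixpoint pull_out (phi : form A) (s : sahlqvist_antecedent phi) (n x : nat) :
    seq clause * nat :=
  match s with
  | SqBot => ([:: Clause [::] (FConst \bot) [::] [::]], n)
  | SqTop => ([:: Clause [::] (FConst \top) [::] [::]], n)
  | SqBoxedAtom r p => ([:: Clause [::] (FConst \top) [:: (p, r, x)] [::]], n)
  | SqNegative nu _ => ([:: Clause [::] (FConst \top) [::] [:: (x, nu)]], n)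
  | SqAnd _ _ s1 s2 =>
      let: (cs1, n1) := pull_out s1 n x in
      let: (cs2, n2) := pull_out s2 n1 x in
      ([seq clause_and c1 c2 | c1 <- cs1, c2 <- cs2], n2)
  | SqOr _ _ s1 s2 =>
      let: (cs1, n1) := pull_out s1 n x in
      let: (cs2, n2) := pull_out s2 n1 x in
      (cs1 ++ cs2, n2)
  | SqDia _ s1 =>
      let: (cs, m) := pull_out s1 n.+1 n in
      (map (clause_dia x n) cs, m)
  end.

Definition minimal_instance (c : clause) (p y : nat) : frame_form A :=
  fo_disj [seq Rpow b.1.2 b.2 y | b <- cbox c & b.1.1 == p].

(* The minimal instantiation turns BOX-AT into a validity, and BOX-AT is      *)
(* dropped. NEG stays in the antecedent: moving it to the succedent as a      *)
(* disjunct ~ NEG is only classically an equivalence.                         *)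
Definition clause_correspondent (m x : nat) (psi : form A) (c : clause) :
    frame_form A :=
  let sigma := minimal_instance c in
  let NEG := fo_conj [seq ST m nu.1 nu.2 | nu <- cneg c] in
  foldr (@FAll A void)
    (FImp (FAnd (crel c) (subst sigma NEG)) (subst sigma (ST m x psi)))
    (cvars c).

Fixpoint correspondent_at (chi : form A) (s : sahlqvist chi) (x : nat) :
    frame_form A :=
  match s with
  | SqImplication _ psi s1 _ =>
      let: (cs, m) := pull_out s1 x.+1 x in
      fo_conj [seq clause_correspondent m x psi c | c <- cs]
  | SqBox _ s1 => FAll x.+1 (FImp (FRel x x.+1) (correspondent_at s1 x.+1))
  | SqConj _ _ s1 s2 => FAnd (correspondent_at s1 x) (correspondent_at s2 x)
  | SqDisj _ _ s1 s2 _ => FOr (correspondent_at s1 x) (correspondent_at s2 x)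
  end.

End Algorithm.

(* The variable x of alpha(x) is named 0. *)
Definition sahlqvist_van_benthem {d : Order.disp_t} {A : heytingType d}
    (chi : form A) (s : sahlqvist chi) : frame_form A :=
  correspondent_at s 0.

(* Main.v *)
(** For a single clause [exists xs, rel /\ BOX-AT /\ NEG] of the antecedent, let
    [U] be the minimal valuation.  It gives BOX-AT the value [\top], so validity
    yields the correspondent.  Conversely, for an arbitrary valuation [V] whose
    boxed atoms have value [b], only the relativised inequality
    [b /\ U p w <= V p w] holds; but the connectives respect such inequalities
    in a Heyting algebra, so [b /\ NEG(V) <= NEG(U)] and
    [b /\ psi(U) <= psi(V)], which is all that is needed.  Boxes are
    handled by letting the truth degree [a] vary.  Perfection beyond
    completeness is used for disjunctions alone: completely join-irreducible
    elements are join-prime in a Heyting algebra, hence binary joins distribute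
    over arbitrary meets. *)

Require Import Defs.
From HB Require Import structures.
From mathcomp Require Import all_boot all_order.
From mathcomp Require Import boolp classical_sets.

Set Implicit Arguments.
Unset Strict Implicit.
Unset Printing Implicit Defensive.

Import Order.Theory.

Local Open Scope order_scope.

(** Classical equality gives sense to [\in] for lists of clauses and of pairs containing
    formulas. *)
HB.instance Definition _ (A : Type) := gen_eqMixin (form A).
HB.instance Definition _ d (A : heytingType d) := gen_eqMixin (@clause d A).

(** * Bounds and join-prime elements in complete Heyting algebras *)

Section CompleteHeyting.
Context {d : Order.disp_t} {A : heytingType d} (cA : complete_lattice A).
Implicit Types a b : A.

Lemma bigjoinP (I : Type) (f : I -> A) b :
  bigjoin f <= b <-> forall i, f i <= b.
Proof.
have [ubs lbs] : supremums (range f) (bigjoin f).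
  (* On an empty range [supremum] returns its default [\bot], which is then the true supremum;
     otherwise completeness supplies the chosen one. *)
  rewrite /bigjoin /supremum; case: eqP => [->|_].
    by split=> // x _; exact: le0x.
  by case: (cA (range f)) => [[x Hx] _]; apply: (xgetPex _ (ex_intro _ x Hx)).
split=> [le_b i|le_b].
- by apply: le_trans le_b; apply: ubs; exists i.
- by apply: lbs => _ [i _ <-].
Qed.

Lemma bigmeetP (I : Type) (f : I -> A) b :
  b <= bigmeet f <-> forall i, b <= f i.
Proof.
have [lbs ubs] : infimums (range f) (bigmeet f).
  rewrite /bigmeet /infimum; case: eqP => [->|_].
    by split=> // x _; exact: lex1.
  by case: (cA (range f)) => [_ [x Hx]]; apply: (xgetPex _ (ex_intro _ x Hx)).
split=> [le_b i|le_b].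
- by apply: le_trans le_b _; apply: lbs; exists i.
- by apply: ubs => _ [i _ <-].
Qed.

Lemma bigmeet_le (I : Type) (f : I -> A) i : bigmeet f <= f i.
Proof. exact: (bigmeetP f _).1 (lexx _) i. Qed.

Lemma le_bigjoin (I : Type) (f : I -> A) i : f i <= bigjoin f.
Proof. exact: (bigjoinP f _).1 (lexx _) i. Qed.

Lemma himp_mp (x y z : A) :
  x <= himp y z -> forall b, b <= x -> b <= y -> b <= z.
Proof.
by rewrite -himpP => xy_z b bx b_y; apply: le_trans xy_z; rewrite lexI bx.
Qed.

(** Distributivity makes [j] the supremum of the pair [j /\ x], [j /\ y], so irreducibility
    identifies it with one of the two. *)
Lemma join_irreducible_prime (j x y : A) :
  completely_join_irreducible j -> j <= x `|` y -> (j <= x) || (j <= y).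
Proof.
move=> ji j_xy.
have : [set Order.meet j x; Order.meet j y]%classic j.
  apply: ji; split=> [_ [|] -> /=|z ub_z]; [exact: leIl|exact: leIl|].
  have xz : j `&` x <= z by apply: ub_z; left.
  have yz : j `&` y <= z by apply: ub_z; right.
  have : x `|` y <= himp j z by rewrite leUx -!himpP ![_ `&` j]meetC xz.
  by move=> /(le_trans j_xy); rewrite -himpP meetxx.
by case=> ->; rewrite leIr ?orbT.
Qed.

(** It suffices to test irreducible [j <= a]. If [j] fails to lie below a single [f i], primeness at
    that [i] forces [j] below every [g k]. *)
Lemma join_bigmeetP (I J : Type) (f : I -> A) (g : J -> A) a :
  join_dense [set j : A | completely_join_irreducible j]%classic ->
  (forall i k, a <= f i `|` g k) -> a <= bigmeet f `|` bigmeet g.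
Proof.
move=> dA le_fg; have [S Sji [ubS lbS]] := dA a.
apply: lbS => j Sj.
have prime_j i k : (j <= f i) || (j <= g k).
  apply: join_irreducible_prime; first exact: Sji.
  by apply: le_trans (le_fg i k); apply: ubS.
have [le_f|/existsNP[i /negP/negbTE not_fi]] := pselect (forall i, j <= f i).
  by apply: le_trans (leUl _ _); apply/bigmeetP.
apply: le_trans (leUr _ _); apply/bigmeetP => k.
by have := prime_j i k; rewrite not_fi.
Qed.

Section Frame.
Variable F : frame A.
Implicit Types (u w : F) (v : nat -> F) (U V : nat -> F -> A).
Implicit Types (phi psi : form A) (c : clause (A := A)).

Lemma updateE v n u : update v n u n = u.
Proof. by rewrite /update eqxx. Qed.

Lemma update_lt v n u i : (i < n)%N -> update v n u i = v i.
Proof. by rewrite /update => /ltn_eqF ->. Qed.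

(** * Modal values under a change of valuation *)

Lemma eq_value_vars phi U V :
  {in vars phi, U =1 V} -> forall w, value U phi w = value V phi w.
Proof.
elim: phi => //= [p|phi IH1 psi IH2|phi IH1 psi IH2
  |phi IH1 psi IH2|phi IH|phi IH] eqUV w.
- by rewrite eqUV // mem_head.
- 1-3: by rewrite IH1 ?IH2 // => p p_in; apply: eqUV; rewrite mem_cat p_in ?orbT.
- by congr bigmeet; apply/funext => u; rewrite IH.
- by congr bigjoin; apply/funext => u; rewrite IH.
Qed.

(** Both polarities go through one induction, because the left argument of an implication exchanges
    [U] and [V]. Meeting with [b] distributes over the joins of diamonds, and passes through boxes
    and implications by residuation. *)
Lemma le_value_relative b phi (pol : bool) U V :
  (pol -> forall p w, b `&` U p w <= V p w) ->
  (~~ pol -> forall p w, b `&` V p w <= U p w) ->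
  polarized pol phi ->
  forall w, b `&` value U phi w <= value V phi w.
Proof.
elim: phi pol U V => /= [e|p|phi IH1 psi IH2|phi IH1 psi IH2
  |phi IH1 psi IH2|phi IH|phi IH] pol U V UV VU.
- by move=> _ w; exact: leIr.
- by move=> Hpol w; apply: UV.
- case/andP=> pol1 pol2 w; rewrite meetC himpP leUx -!himpP ![_ `&` b]meetC.
  by rewrite (le_trans (IH1 _ _ _ UV VU pol1 w)) ?leUl //=
             (le_trans (IH2 _ _ _ UV VU pol2 w)) ?leUr.
- case/andP=> pol1 pol2 w; rewrite lexI.
  by rewrite (le_trans _ (IH1 _ _ _ UV VU pol1 w))
             ?(le_trans _ (IH2 _ _ _ UV VU pol2 w)) //;
     rewrite leI2 ?leIl ?leIr.
- case/andP=> pol1 pol2 w.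
  have VU' : ~~ ~~ pol -> forall p u, b `&` U p u <= V p u by rewrite negbK.
  rewrite -himpP; apply: le_trans (IH2 _ _ _ UV VU pol2 w).
  have le_b : b `&` himp (value U phi w) (value U psi w) `&` value V phi w <= b.
    by rewrite -meetA leIl.
  rewrite lexI le_b /=; apply: (himp_mp (lexx (himp (value U phi w) _))).
    by apply: leIx2; rewrite leIr.
  by apply: le_trans (IH1 _ _ _ VU VU' pol1 w); rewrite lexI le_b leIr.
- move=> pol1 w; apply/bigmeetP => u; rewrite -himpP.
  apply: le_trans (IH _ _ _ UV VU pol1 u); rewrite -meetA leI2 //.
  rewrite himpP; exact: bigmeet_le.
- move=> pol1 w; rewrite meetC himpP; apply/bigjoinP => u; rewrite -himpP.
  rewrite -meetA; apply: (@le_trans _ _ (acc w u `&` value V phi u)).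
    by rewrite leI2 // meetC (IH _ _ _ UV VU pol1 u).
  exact: (le_bigjoin (fun u => acc w u `&` value V phi u)).
Qed.

(** * Relational powers and boxed atoms *)

Fixpoint path_value (r : nat) (w u : F) : A :=
  if r is r'.+1 then bigjoin (fun z : F => acc w z `&` path_value r' z u)
  else if `[< w = u >] then \top else \bot.

Lemma fo_value_Rpow r v x y :
  fo_value v (Rpow r x y) = path_value r (v x) (v y).
Proof.
elim: r v x => [|[|r] IH] v x //.
(* [Rpow] takes [R] itself as first power, [path_value] takes [R] composed with the identity; the
   join is attained at [v y]. *)
- rewrite /=; apply/eqP; rewrite eq_le; apply/andP; split; last first.
    apply/bigjoinP => z; case: asboolP => [->|_]; first by rewrite meetx1.
    by rewrite meetx0 le0x.
  apply: le_trans (le_bigjoin _ (v y)).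
  by case: asboolP => // _; rewrite meetx1.
- change (bigjoin (fun u => fo_value (update v (maxn x y).+1 u)
     (FAnd (FRel x (maxn x y).+1) (Rpow r.+1 (maxn x y).+1 y))) =
     bigjoin (fun z => acc (v x) z `&` path_value r.+1 z (v y))).
  congr bigjoin; apply/funext => u.
  have -> : fo_value (update v (maxn x y).+1 u)
     (FAnd (FRel x (maxn x y).+1) (Rpow r.+1 (maxn x y).+1 y)) =
     acc (update v (maxn x y).+1 u x) (update v (maxn x y).+1 u (maxn x y).+1) `&`
     fo_value (update v (maxn x y).+1 u) (Rpow r.+1 (maxn x y).+1 y) by [].
  by rewrite IH updateE !update_lt // ltnS ?leq_maxl ?leq_maxr.
Qed.

(** Residuation trades nested meets of implications for one join over paths. At [b = \top] it shows
    [path_value r w] to be the least value of [p] that makes the boxed atom fully true at [w]. *)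
Lemma le_boxed_atom r p V w b :
  b <= value V (iter r (@Box A) (Var p)) w <->
  forall u, b `&` path_value r w u <= V p u.
Proof.
elim: r w b => [|r IH] w b /=.
  split=> [le_b u|/(_ w)]; last by rewrite asboolT // meetx1.
  by case: asboolP => [<-|_]; rewrite ?meetx1 // meetx0 le0x.
split=> [/bigmeetP le_b u|le_b].
- rewrite meetC himpP; apply/bigjoinP => z; rewrite -himpP meetC meetA.
  by move: u; apply/IH; rewrite himpP.
- apply/bigmeetP => z; rewrite -himpP; apply/IH => u.
  apply: le_trans (le_b u); rewrite -meetA leI2 //.
  exact: (le_bigjoin (fun z => acc w z `&` path_value r z u)).
Qed.

(** * First-order evaluation and the standard translation *)

Lemma fo_value_conj (s : seq (frame_form A)) v :
  fo_value v (fo_conj s) = \meet_(f <- [seq fo_value v f | f <- s]) f.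
Proof. by elim: s => [|f s IH] /=; rewrite ?big_nil // big_cons -IH. Qed.

Lemma fo_value_disj (s : seq (frame_form A)) v :
  fo_value v (fo_disj s) = \join_(f <- [seq fo_value v f | f <- s]) f.
Proof. by elim: s => [|f s IH] /=; rewrite ?big_nil // big_cons -IH. Qed.

Lemma subst_conj sigma (s : seq (fo A nat)) :
  subst sigma (fo_conj s) = fo_conj [seq subst sigma f | f <- s].
Proof. by elim: s => //= f s ->. Qed.

Lemma le_fo_value_foralls (xs : seq nat) v beta b :
  b <= fo_value v (foldr (@FAll A void) beta xs) <->
  forall v', (forall i, i \notin xs -> v' i = v i) -> b <= fo_value v' beta.
Proof.
elim: xs v => [|y xs IH] v /=.
  split=> [le_b v' eq_v|]; last exact.
  by rewrite (_ : v' = v) //; apply/funext => i; apply: eq_v.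
split=> [/bigmeetP le_b v' eq_v|le_b].
- have /IH := le_b (v' y); apply=> i i_xs; rewrite /update.
  by case: eqP => [->//|/eqP ne]; apply: eq_v; rewrite inE negb_or ne.
- apply/bigmeetP => u; apply/IH => v' eq_v; apply: le_b => i.
  by rewrite inE negb_or => /andP[/negbTE ne i_xs]; rewrite eq_v // /update ne.
Qed.

Definition agree (n : nat) v v' : Prop := forall i, (i < n)%N -> v' i = v i.

(** The translation binds only variables from [n >= m] on, so every update keeps agreement below
    [m], where [sigma] has its parameters. This is how capture is excluded. *)
Lemma fo_value_ST sigma U m v :
  (forall p y v', agree m v v' -> fo_value v' (sigma p y) = U p (v' y)) ->
  forall phi n x v', (m <= n)%N -> (x < n)%N -> agree m v v' ->
  fo_value v' (subst sigma (ST n x phi)) = value U phi (v' x).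
Proof.
move=> sigmaE; elim=> [e|p|phi IH1 psi IH2|phi IH1 psi IH2
  |phi IH1 psi IH2|phi IH|phi IH] n x v' mn xn vv' /=.
- by [].
- exact: sigmaE.
- 1-3: by rewrite IH1 ?IH2.
all: have up u : agree m v (update v' n u)
  by move=> i im; rewrite update_lt ?vv' // (leq_trans im).
- congr bigmeet; apply/funext => u.
  by rewrite IH ?ltnS ?(leqW mn) // updateE update_lt.
- congr bigjoin; apply/funext => u.
  by rewrite IH ?ltnS ?(leqW mn) // updateE update_lt.
Qed.

(** * Clauses and the pulling out of existential quantifiers *)

Definition box_value V v c : A :=
  \meet_(t <- cbox c) value V (iter t.1.2 (@Box A) (Var t.1.1)) (v t.2).
Definition neg_value V v c : A :=
  \meet_(nu <- cneg c) value V nu.2 (v nu.1).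
Definition clause_value V v c : A :=
  fo_value v (crel c) `&` (box_value V v c `&` neg_value V v c).

Lemma clause_value_and V v c1 c2 :
  clause_value V v (clause_and c1 c2) =
  clause_value V v c1 `&` clause_value V v c2.
Proof.
rewrite /clause_value /box_value /neg_value /= !big_cat /=.
by rewrite [X in _ `&` X = _]meetACA meetACA.
Qed.

(** Bounds the free variables of [c]. For [crel] the condition is semantic, which spares a syntactic
    account of free variables. *)
Definition depends_on (X : seq nat) c : Prop :=
  [/\ forall v v', {in X, v =1 v'} -> fo_value v (crel c) = fo_value v' (crel c),
      {in cbox c, forall t, t.2 \in X} & {in cneg c, forall nu, nu.1 \in X}].

Lemma eq_box_value X c V v v' :
  depends_on X c -> {in X, v =1 v'} -> box_value V v c = box_value V v' c.
Proof.
move=> [_ dep _] eqv; apply: eq_big_seq => b b_c.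
by rewrite eqv // dep.
Qed.

Lemma eq_neg_value X c V v v' :
  depends_on X c -> {in X, v =1 v'} -> neg_value V v c = neg_value V v' c.
Proof.
move=> [_ _ dep] eqv; apply: eq_big_seq => b b_c.
by rewrite eqv // dep.
Qed.

Lemma eq_clause_value X c V v v' :
  depends_on X c -> {in X, v =1 v'} -> clause_value V v c = clause_value V v' c.
Proof.
move=> dep eqv; rewrite /clause_value (eq_box_value _ dep eqv).
by rewrite (eq_neg_value _ dep eqv); case: dep => /(_ _ _ eqv) ->.
Qed.

Lemma depends_on_sub X Y c :
  {subset X <= Y} -> depends_on X c -> depends_on Y c.
Proof.
move=> sXY [rel box neg]; split=> [v v' eqv|b /box/sXY|nu /neg/sXY] //.
by apply: rel => i /sXY/eqv.
Qed.

Lemma depends_on_and X c1 c2 :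
  depends_on X c1 -> depends_on X c2 -> depends_on X (clause_and c1 c2).
Proof.
move=> [rel1 box1 neg1] [rel2 box2 neg2]; split=> /=.
- by move=> v v' eqv; rewrite (rel1 _ _ eqv) (rel2 _ _ eqv).
- by move=> b; rewrite mem_cat => /orP[/box1|/box2].
- by move=> b; rewrite mem_cat => /orP[/neg1|/neg2].
Qed.

(** Successive runs draw their variables from consecutive intervals, so clauses of different
    subformulas share no pulled-out variable. *)
Definition pulled_out (n x m : nat) c : Prop :=
  {in cvars c, forall i, (n <= i < m)%N} /\ depends_on (x :: cvars c) c.

Lemma pull_out_pulled_out phi (s : sahlqvist_antecedent phi) n x :
  let: (cs, m) := pull_out s n x in
  (n <= m)%N /\ {in cs, forall c, pulled_out n x m c}.
Proof.
elim: s n x => [||r p|nu negnu|f g sf IHf sg IHg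
  |f g sf IHf sg IHg|f sf IHf] n x /=;
  try (split=> // c; rewrite inE => /eqP ->; split=> //; split=> //= b;
       by rewrite inE => /eqP -> /=; rewrite mem_head).
- have := IHf n x; case: (pull_out sf n x) => cs1 n1 [nn1 H1].
  have := IHg n1 x; case: (pull_out sg n1 x) => cs2 n2 [n12 H2].
  split=> [|_ /allpairsP[[c1 c2] /= [/H1[r1 d1] /H2[r2 d2] ->]]].
    exact: leq_trans n12.
  split=> [i|] /=.
    rewrite mem_cat => /orP[/r1/andP[ni im]|/r2/andP[ni im]].
      by rewrite ni (leq_trans im).
    by rewrite im (leq_trans nn1).
  apply: depends_on_and; [apply: depends_on_sub d1|apply: depends_on_sub d2];
    by move=> i; rewrite !inE mem_cat => /orP[]->; rewrite ?orbT.
- have := IHf n x; case: (pull_out sf n x) => cs1 n1 [nn1 H1].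
  have := IHg n1 x; case: (pull_out sg n1 x) => cs2 n2 [n12 H2].
  split=> [|c]; first exact: leq_trans n12.
  rewrite mem_cat => /orP[/H1[r1 d1]|/H2[r2 d2]]; split=> // i.
    by move=> /r1/andP[ni im]; rewrite ni (leq_trans im).
  by move=> /r2/andP[ni im]; rewrite im (leq_trans nn1).
- have := IHf n.+1 n; case: (pull_out sf n.+1 n) => cs m [nm H].
  split=> [|_ /mapP[c /H[rc dc] ->]]; first exact: ltnW.
  split=> [i|] /=.
    rewrite inE => /orP[/eqP->|/rc/andP[ni ->]]; first by rewrite leqnn.
    by rewrite (ltnW ni).
  have [rel box neg] := dc; split=> /= [v v' eqv|b /box|b /neg]; last first.
  - by move=> t_in; rewrite inE t_in orbT.
  - by move=> t_in; rewrite inE t_in orbT.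
  rewrite !eqv ?inE ?eqxx ?orbT //; congr (_ `&` _).
  by apply: rel => i i_in; apply: eqv; rewrite inE i_in orbT.
Qed.

(* Ranging over all assignments that agree below [n], and not only over those
   that differ from [v] on [cvars c], makes the assignment a single object that
   all clauses produced along the recursion can share. *)
Lemma value_antecedent_le phi (s : sahlqvist_antecedent phi) n x V v b :
  (x < n)%N ->
  value V phi (v x) <= b <->
  forall c v', c \in (pull_out s n x).1 -> agree n v v' ->
    clause_value V v' c <= b.
Proof.
elim: s n x v b => [||r p|nu negnu|f g sf IHf sg IHg
  |f g sf IHf sg IHg|f sf IHf] n x v b xn /=.
- split=> [_ c v'|_]; last exact: le0x.
  by rewrite inE => /eqP-> _; rewrite /clause_value /= meet0x le0x.
- split=> [le_b c v'|/(_ (Clause [::] (FConst \top) [::] [::]) v)].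
    by rewrite inE => /eqP-> _; apply: le_trans le_b; exact: lex1.
  by rewrite inE eqxx /clause_value /box_value /neg_value !big_nil /= !meetx1; apply.
- have E v' : agree n v v' ->
    clause_value V v' (Clause [::] (FConst \top) [:: (p, r, x)] [::]) =
    value V (iter r (@Box A) (Var p)) (v x).
    move=> vv'; rewrite /clause_value /box_value /neg_value /= big_seq1 big_nil.
    by rewrite meet1x meetx1 /= vv'.
  split=> [le_b c v'|].
    by rewrite inE => /eqP-> /E ->.
  by move/(_ (Clause [::] (FConst \top) [:: (p, r, x)] [::]) v);
    rewrite E // inE eqxx; apply.
- have E v' : agree n v v' ->
    clause_value V v' (Clause [::] (FConst \top) [::] [:: (x, nu)]) =
    value V nu (v x).
    move=> vv'; rewrite /clause_value /box_value /neg_value /= big_seq1 big_nil.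
    by rewrite !meet1x /= vv'.
  split=> [le_b c v'|].
    by rewrite inE => /eqP-> /E ->.
  by move/(_ (Clause [::] (FConst \top) [::] [:: (x, nu)]) v);
    rewrite E // inE eqxx; apply.
- have := IHf n x; have := pull_out_pulled_out sf n x.
  case: (pull_out sf n x) => cs1 n1 [nn1 H1] {}IHf.
  have := IHg n1 x; case: (pull_out sg n1 x) => cs2 n2 /= {}IHg.
  have xn1 : (x < n1)%N by apply: leq_trans nn1.
  (* The conjunction is curried: [f] is bounded by [himp (value V g (v x)) b], and then [g] is
     treated from the assignment chosen for [f]. *)
  rewrite himpP; split=> [/(IHf _ _ xn) le_b c v'|le_b].
    case/allpairsP=> [[c1 c2] /= [c1_in c2_in ->]] vv'.
    rewrite clause_value_and meetC himpP.
    suff /(IHg _ _ xn1) : value V g (v' x) <= himp (clause_value V v' c1) b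
      by apply.
    by rewrite -himpP meetC himpP vv' //; apply: le_b.
  apply/(IHf _ _ xn) => c1 v1 c1_in vv1; rewrite -himpP meetC himpP -vv1 //.
  apply/(IHg _ _ xn1) => c2 v2 c2_in v12; rewrite -himpP meetC.
  have [r1 d1] := H1 _ c1_in.
  (* [c1] sees only variables below [n1], where [v1] and [v2] agree, so both clauses can be read at
     [v2]. *)
  rewrite (eq_clause_value V d1 (v' := v2)).
    rewrite -clause_value_and; apply: le_b; first exact: allpairs_f.
    by move=> i i_n; rewrite v12 ?vv1 // (leq_trans i_n).
  by move=> i; rewrite inE => /orP[/eqP->|/r1/andP[_ im]]; rewrite v12.
- have := IHf n x; have := pull_out_pulled_out sf n x.
  case: (pull_out sf n x) => cs1 n1 [nn1 _] {}IHf.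
  have := IHg n1 x; have := pull_out_pulled_out sg n1 x.
  case: (pull_out sg n1 x) => cs2 n2 /= [_ H2] {}IHg.
  have xn1 : (x < n1)%N by apply: leq_trans nn1.
  rewrite leUx; split=> [/andP[/(IHf _ _ xn) le1 /(IHg _ _ xn1) le2] c v'|le_b].
    rewrite mem_cat => /orP[|c_in] vv'; first by move=> /le1; apply.
    have [r2 d2] := H2 _ c_in.
    (* The hypothesis for [g] wants agreement below [n1], but [v'] agrees with [v] only below [n].
       Resetting the variables below [n1] is invisible to [c], which uses [x] and variables from
       [n1] on. *)
    rewrite (eq_clause_value V d2 (v' := fun i => if (i < n1)%N then v i else v' i)).
      by apply: le2 => // i ->.
    move=> i; rewrite inE => /orP[/eqP->|/r2/andP[n1i _]].
      by rewrite xn1 vv'.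
    by rewrite ltnNge n1i.
  apply/andP; split.
    by apply/(IHf _ _ xn) => c v' c_in vv'; apply: le_b; rewrite ?mem_cat ?c_in.
  apply/(IHg _ _ xn1) => c v' c_in vv'; apply: le_b; rewrite
    ?mem_cat ?c_in ?orbT //.
  by move=> i i_n; apply: vv'; apply: leq_trans nn1.
- have := IHf n.+1 n; case: (pull_out sf n.+1 n) => cs m /= {}IHf.
  have diaE v' c : clause_value V v' (clause_dia x n c) =
      acc (v' x) (v' n) `&` clause_value V v' c.
    by rewrite /clause_value /= -meetA.
  split=> [/bigjoinP le_b _ v' /mapP[c c_in ->] vv'|le_b].
    rewrite diaE meetC himpP.
    suff /(IHf _ _ (ltnSn n)) : value V f (v' n) <= himp (acc (v' x) (v' n)) b
      by apply.
    by rewrite -himpP meetC vv'.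
  (* The successor [u] is stored in the fresh variable [n], at which the subformula is then
     evaluated. *)
  apply/bigjoinP => u; rewrite meetC himpP -[u in value _ _ u](updateE v n u).
  apply/(IHf _ _ (ltnSn n)) => c v' c_in vv'; rewrite -himpP meetC.
  have -> : acc (v x) u = acc (v' x) (v' n).
    by rewrite (vv' n) // (vv' x) ?leqW // updateE update_lt.
  rewrite -diaE; apply: le_b; first exact: map_f.
  by move=> i i_n; rewrite vv' ?leqW // update_lt.
Qed.

(** * Minimal valuations and the correspondent of one clause *)

Definition minimal_valuation v c (p : nat) (u : F) : A :=
  \join_(t <- cbox c | t.1.1 == p) path_value t.1.2 (v t.2) u.

Lemma fo_value_minimal_instance v c p y :
  fo_value v (minimal_instance c p y) = minimal_valuation v c p (v y).
Proof.
rewrite /minimal_instance fo_value_disj -map_comp big_map big_filter.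
by apply: eq_bigr => t _ /=; rewrite fo_value_Rpow.
Qed.

Lemma eq_minimal_valuation X c v v' :
  depends_on X c -> {in X, v =1 v'} ->
  minimal_valuation v c = minimal_valuation v' c.
Proof.
move=> [_ dep _] eqv; apply/funext => p; apply/funext => u.
rewrite /minimal_valuation big_seq_cond [RHS]big_seq_cond.
by apply: eq_bigr => t /andP[t_c _]; rewrite eqv // dep.
Qed.

Lemma box_value_minimal v c : box_value (minimal_valuation v c) v c = \top.
Proof.
apply/eqP; rewrite -le1x; apply/meetsP_seq => t t_c _.
apply/le_boxed_atom => u; rewrite meet1x.
exact: (joins_sup_seq (fun t => path_value t.1.2 (v t.2) u)).
Qed.

Lemma minimal_valuation_le v c V p w :
  box_value V v c `&` minimal_valuation v c p w <= V p w.
Proof.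
rewrite meetC himpP; apply/joinsP_seq => t t_c /eqP <-; rewrite -himpP meetC.
apply: (le_boxed_atom _ _ _ _ _).1.
exact: (meets_inf_seq
  (fun t => value V (iter t.1.2 (@Box A) (Var t.1.1)) (v t.2))).
Qed.

(** The degree [b] sits inside the bound on the clause, the shape that [value_antecedent_le]
    consumes. *)
Lemma le_clause_correspondent n m x psi c v b :
  (x < n)%N -> (n <= m)%N -> positive psi ->
  {in cneg c, forall nu, negative nu.2} -> pulled_out n x m c ->
  b <= fo_value v (clause_correspondent m x psi c) <->
  forall V v', agree n v v' -> clause_value V v' c <= himp b (value V psi (v x)).
Proof.
move=> xn nm pos_psi neg_c [range_c dep_c].
(* The parameters of the minimal instance lie below [m], as [fo_value_ST] demands. *)
have X_lt i : i \in x :: cvars c -> (i < m)%N.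
  rewrite inE => /orP[/eqP->|/range_c/andP[]//]; exact: leq_trans nm.
have agree_off v' : (forall i, i \notin cvars c -> v' i = v i) -> agree n v v'.
  move=> vv' i i_n; apply: vv'; apply/negP => /range_c/andP[].
  by rewrite leqNgt i_n.
have bodyE v' : fo_value v'
    (FImp (FAnd (crel c) (subst (minimal_instance c)
        (fo_conj [seq ST m nu.1 nu.2 | nu <- cneg c])))
      (subst (minimal_instance c) (ST m x psi))) =
    himp (fo_value v' (crel c) `&` neg_value (minimal_valuation v' c) v' c)
      (value (minimal_valuation v' c) psi (v' x)).
  have sigmaE p y v2 : agree m v' v2 ->
      fo_value v2 (minimal_instance c p y) = minimal_valuation v' c p (v2 y).
    move=> eqv; rewrite fo_value_minimal_instance.
    by rewrite (eq_minimal_valuation dep_c (v' := v')) // => i /X_lt/eqv.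
  rewrite /= (fo_value_ST sigmaE) ?X_lt ?mem_head //.
  rewrite subst_conj fo_value_conj -!map_comp big_map.
  congr (himp (_ `&` _) _); apply: eq_big_seq => nu nu_c /=.
  by rewrite (fo_value_ST sigmaE) // X_lt //; case: dep_c => _ _; apply.
rewrite /clause_correspondent le_fo_value_foralls.
split=> [le_b V v' vv'|le_b v' vv'].
(* [le_b] covers only assignments that differ from [v] on [cvars c], whereas [v'] may differ
   anywhere from [n] on. The clause cannot tell [v2] from [v']. *)
- pose v2 i := if i \in cvars c then v' i else v i.
  have v2v' : {in x :: cvars c, v2 =1 v'}.
    move=> i; rewrite /v2; case: ifP => // i_c; rewrite inE i_c orbF => /eqP ->.
    by rewrite vv'.
  have le_b2 : b <= himp (fo_value v2 (crel c) `&`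
      neg_value (minimal_valuation v2 c) v2 c)
      (value (minimal_valuation v2 c) psi (v2 x)).
    by rewrite -bodyE; apply: le_b => i; rewrite /v2 => /negbTE ->.
  have v2x : v2 x = v x by rewrite v2v' ?mem_head // vv'.
  rewrite -(eq_clause_value V dep_c v2v') -himpP -v2x.
  set B := box_value V v2 c; set z := clause_value V v2 c `&` b.
  set U := minimal_valuation v2 c in le_b2 *.
  have BU p w : B `&` U p w <= V p w by exact: minimal_valuation_le.
  have /and3P[zrel zB zneg] :
      [&& z <= fo_value v2 (crel c), z <= B & z <= neg_value V v2 c].
    by rewrite -!lexI leIl.
  have psiUV : B `&` value U psi (v2 x) <= value V psi (v2 x).
    by apply: (le_value_relative (pol := true)).
  apply: le_trans psiUV; rewrite lexI zB /=.
  apply: (himp_mp le_b2); first exact: leIr.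
  rewrite lexI zrel /=; apply/meetsP_seq => nu nu_c _.
  have nuVU : B `&` value V nu.2 (v2 nu.1) <= value U nu.2 (v2 nu.1).
    by apply: (le_value_relative (pol := false)) => //; apply: neg_c.
  apply: le_trans nuVU; rewrite lexI zB /=; apply: le_trans zneg _.
  exact: (meets_inf_seq (fun nu => value V nu.2 (v2 nu.1))).
- rewrite bodyE -himpP.
  have eqx : v' x = v x by apply: agree_off vv' _ xn.
  have := le_b (minimal_valuation v' c) v' (agree_off _ vv').
  by rewrite /clause_value box_value_minimal meet1x -himpP meetC eqx.
Qed.

(** * Correctness of the whole algorithm *)

Lemma pull_out_negative phi (s : sahlqvist_antecedent phi) n x :
  {in (pull_out s n x).1, forall c, {in cneg c, forall nu, negative nu.2}}.
Proof.
elim: s n x => [||r p|nu neg_nu|f g sf IHf sg IHg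
  |f g sf IHf sg IHg|f sf IHf] n x c /=;
  try by rewrite inE => /eqP -> nu'; rewrite ?inE // => /eqP ->.
- have := IHf n x; case: (pull_out sf n x) => cs1 n1 H1.
  have := IHg n1 x; case: (pull_out sg n1 x) => cs2 n2 H2 /=.
  case/allpairsP=> [[c1 c2] /= [/H1 neg1 /H2 neg2 ->]] nu /=.
  by rewrite mem_cat => /orP[/neg1|/neg2].
- have := IHf n x; case: (pull_out sf n x) => cs1 n1 H1.
  have := IHg n1 x; case: (pull_out sg n1 x) => cs2 n2 H2 /=.
  by rewrite mem_cat => /orP[/H1|/H2].
- have := IHf n.+1 n; case: (pull_out sf n.+1 n) => cs m H /=.
  by case/mapP=> c1 /H neg1 ->.
Qed.

Lemma le_correspondent_at chi (s : sahlqvist chi) x v a :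
  join_dense [set j : A | completely_join_irreducible j]%classic ->
  valid_at (v x) a chi <-> a <= fo_value v (correspondent_at s x).
Proof.
move=> dA.
elim: s x v a => [phi psi s pos_psi|phi s IH|phi psi s1 IH1 s2 IH2
  |phi psi s1 IH1 s2 IH2 disj] x v a /=.
- have := @pull_out_negative _ s x.+1 x.
  have := pull_out_pulled_out s x.+1 x.
  have := fun V b => @value_antecedent_le _ s x.+1 x V v b (ltnSn x).
  case: (pull_out s x.+1 x) => cs m /= anteP [nm out] neg.
  have corrP c : c \in cs ->
      a <= fo_value v (clause_correspondent m x psi c) <->
      forall V v', agree x.+1 v v' ->
        clause_value V v' c <= himp a (value V psi (v x)).
    move=> c_in; apply: (le_clause_correspondent (n := x.+1)) => //.
      exact: neg.
    exact: out.
  rewrite fo_value_conj -map_comp big_map.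
  split=> [valid|/meetsP_seq le_a V].
    apply/meetsP_seq => c c_in _; apply/corrP => // V v' vv'.
    suff /anteP : value V phi (v x) <= himp a (value V psi (v x)) by apply.
    by rewrite -himpP meetC himpP; apply: valid.
  rewrite /= -himpP meetC himpP; apply/anteP => c v' c_in vv'.
  by apply: (corrP c c_in).1 => //; apply: le_a.
(* Residuation absorbs the accessibility degree of each successor into the truth degree. *)
- have IHu u : valid_at u (a `&` acc (v x) u) phi <->
      a `&` acc (v x) u <= fo_value (update v x.+1 u) (correspondent_at s x.+1).
    by rewrite -IH updateE.
  split=> [valid|/bigmeetP le_a V /=].
    apply/bigmeetP => u; rewrite -himpP updateE update_lt //.
    by apply/IHu => V; rewrite himpP; apply/bigmeetP: u; apply: valid.
  apply/bigmeetP => u; rewrite -himpP; apply: (IHu u).2.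
  by have := le_a u; rewrite updateE update_lt // -himpP.
- rewrite lexI; split=> [valid|/andP[/IH1 le1 /IH2 le2] V]; last first.
    by rewrite /= lexI le1 le2.
  by apply/andP; split; [apply/IH1|apply/IH2] => V;
    have := valid V; rewrite /= lexI => /andP[].
- split=> [valid|le_a V].
    (* Each meet over all valuations is the largest degree at which its disjunct is valid. *)
    have : a <= bigmeet (fun V => value V phi (v x)) `|`
                bigmeet (fun V => value V psi (v x)).
      apply: join_bigmeetP => // V V'.
      (* As the disjuncts share no variable, one valuation can imitate [V] on [phi] and [V'] on
         [psi]. *)
      pose V2 p := if p \in vars phi then V p else V' p.
      have := valid V2; rewrite /= (@eq_value_vars phi V2 V); last first.
        by move=> p p_in; rewrite /V2 p_in.
      rewrite (@eq_value_vars psi V2 V') // => p p_in; rewrite /V2.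
      by case: ifP => // /disj; rewrite p_in.
    move/le_trans; apply; apply: leU2; [apply/IH1|apply/IH2] => V;
      exact: (bigmeet_le (fun V => value V _ (v x))).
  (* The induction hypotheses are taken at the values of the two correspondents themselves, since
     [a] need not lie below either. *)
  apply: le_trans le_a _; rewrite /=; apply: leU2.
    exact: (IH1 x v _).2 (lexx _) V.
  exact: (IH2 x v _).2 (lexx _) V.
Qed.

End Frame.
End CompleteHeyting.

Theorem theorem7p9 (d : Order.disp_t) (A : heytingType d) (hA : perfect A)
    (a : A) (chi : form A) (s : sahlqvist chi) :
  local_frame_correspondents a chi 0 (sahlqvist_van_benthem s).
Proof.
case: hA => cA dA _ F w; split=> [valid v vw|valid].
- by apply/(le_correspondent_at cA) => //; rewrite vw.
- by apply/(le_correspondent_at cA s 0 (fun=> w)) => //; apply: valid.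
Qed.
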